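(* Let $n\ge2$ and $k,d\ge1$, and for a positive integer $p$ let $\mathbb{Q}_p=\frac1p\mathbb{Z}$. Then $$\alpha(\mathrm{RFA}(\mathbb{Z}^d,n,k))=\alpha(\mathrm{EL}(\mathbb{Z}^d,n,k))=\mathbb{Q}_k^d .$$ In particular, $\mathrm{EL}(\mathbb{Z}^d,n,k)\subsetneq\mathrm{RTM}(\mathbb{Z}^d,n,k)$.
   Context: Let $\Sigma=\{0,\dots,n-1\}$, $Q=\{1,\dots,k\}$. Let $X_k=\{y\in\{0,1,\dots,k\}^{\mathbb{Z}^d} : y_{\vec u}\ne0\text{ and }y_{\vec v}\neq 0\implies \vec u=\vec v\}$ and $X_{n,k}=\Sigma^{\mathbb{Z}^d}\times X_k$. Given finite $F,F'\subset\mathbb{Z}^d$ and $f:\Sigma^F\times Q\to\Sigma^{F'}\times Q\times\mathbb{Z}^d$ (a local rule), the map $T_f:X_{n,k}\to X_{n,k}$ is defined by: $T_f(x,y)=(x,y)$ if $y$ is identically $0$; otherwise let $\vec v$ be the unique position with $q=y_{\vec v}\ne 0$, let $p\in\Sigma^F$ with $p_{\vec u}=x_{\vec v+\vec u}$, and $f(p,q)=(p',q',\vec e)$; then $T_f(x,y)=(\tilde x,\tilde y)$ with $\tilde x_{\vec t}=p'_{\vec t-\vec v}$ if $\vec t-\vec v\in F'$, $\tilde x_{\vec t}=x_{\vec t}$ otherwise, and $\tilde y_{\vec v+\vec e}=q'$, $\tilde y_{\vec t}=0$ for $\vec t\ne\vec v+\vec e$. Such maps are the $(d,n,k)$-Turing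 machines; one is reversible if it has a two-sided inverse that is a $(d,n,k)$-Turing machine. The reversible ones form the group $\mathrm{RTM}(\mathbb{Z}^d,n,k)$ under composition. Subgroups: $\mathrm{RFA}(\mathbb{Z}^d,n,k)$ consists of the reversible machines that do not change the tape, i.e. that have a local rule $f:\Sigma^F\times Q\to\Sigma^F\times Q\times\mathbb{Z}^d$ with $f(p,q)=(p,q',\vec z)$ for all $p,q$. $\mathrm{LP}(\mathbb{Z}^d,n,k)$ consists of the reversible machines that never move the head (move component of the local rule constantly $\vec 0$). $\mathrm{EL}(\mathbb{Z}^d,n,k)=\langle\mathrm{RFA}(\mathbb{Z}^d,n,k),\mathrm{LP}(\mathbb{Z}^d,n,k)\rangle$. Average movement: for a machine $T$, define $\Psi(T):\Sigma^{\mathbb{Z}^d}\times Q\to\Sigma^{\mathbb{Z}^d}\times Q$ by $\Psi(T)(x,q)=(\sigma_{-\vec v}(x'),q')$, where $y$ has $y_{\vec 0}=q$ and $0$ elsewhere, $T(x,y)=(x',y')$, and $y'_{\vec v}=q'\ne0$; here $(\sigma_{\vec v}(x))_{\vec u}=x_{\vec u-\vec v}$. The shift indicator of $\Psi(T)$ is the (for $n\ge2$ unique) continuous function $s:\Sigma^{\mathbb{Z}^d}\times Q\to\mathbb{Z}^d$ for which there is $a\in\mathbb{N}$ such that for all $(x,q)$ the first component of $\Psi(T)(x,q)$ agrees with $\sigma_{s(x,q)}(x)$ at all positions $\vec u$ with $\|\vec u\|_\infty\ge a$. Then $\alpha(T)=\int_{\Sigma^{\mathbb{Z}^d}\times Q}s\,d\mu\in\mathbb{Q}^d$,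 where $\mu$ is the product of the uniform Bernoulli measure on $\Sigma^{\mathbb{Z}^d}$ and the uniform probability measure on $Q$. *)

(* Defs.v *)
From HB Require Import structures.
From mathcomp Require Import all_boot all_order all_algebra finmap.
From mathcomp Require Import all_classical all_reals all_analysis.

Set Implicit Arguments.
Unset Strict Implicit.
Unset Printing Implicit Defensive.
Import Order.TTheory GRing.Theory Num.Theory.

Local Open Scope classical_set_scope.
Local Open Scope ring_scope.

Notation Zd d := ('rV[int]_d).

Section Machines.
Variables d n k : nat.

Definition config := Zd d -> 'I_n.

(* The state set {1, ..., k} is represented by 'I_k, a state q : 'I_k being
   read as the nonzero element lift ord0 q of {0, ..., k} = 'I_k.+1. *)
Definition headtrack :=
  {y : Zd d -> 'I_k.+1 | forall u v, y u <> ord0 -> y v <> ord0 -> u = v}.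

Definition tapes := (config * headtrack)%type.

Fact head_at_subproof (q : 'I_k) (v : Zd d) :
  let y t := if t == v then lift ord0 q else ord0 in
  forall u w, y u <> ord0 -> y w <> ord0 -> u = w.
Proof. by move=> /= u w; do 2!case: eqP => [->|] //. Qed.

Definition head_at (q : 'I_k) (v : Zd d) : headtrack :=
  exist _ _ (@head_at_subproof q v).

Definition find_head (y : headtrack) : option (Zd d * 'I_k) :=
  match pselect (exists vq : Zd d * 'I_k, sval y vq.1 = lift ord0 vq.2) with
  | left h => Some (sval (cid h))
  | right _ => None
  end.

Definition local_rule (F F' : {fset Zd d}) :=
  {ffun F -> 'I_n} * 'I_k -> {ffun F' -> 'I_n} * 'I_k * Zd d.

Definition TM_of (F F' : {fset Zd d}) (f : local_rule F F') : tapes -> tapes :=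
  fun z => let (x, y) := z in
  match find_head y with
  | None => (x, y)
  | Some (v, q) =>
      let '(p', q', e) := f ([ffun u : F => x (v + val u)], q) in
      (fun t => if insub (t - v) is Some w then p' w else x t,
       head_at q' (v + e))
  end.

Definition is_TM (T : tapes -> tapes) :=
  exists (F F' : {fset Zd d}) (f : local_rule F F'), T = TM_of f.

Definition RTM : set (tapes -> tapes) :=
  [set T | is_TM T /\ exists T', [/\ is_TM T', cancel T T' & cancel T' T]].

Definition RFA : set (tapes -> tapes) :=
  [set T | RTM T /\ exists (F : {fset Zd d}) (f : local_rule F F),
     (forall p q, exists q' z, f (p, q) = (p, q', z)) /\ T = TM_of f].

Definition LP : set (tapes -> tapes) :=
  [set T | RTM T /\ exists (F F' : {fset Zd d}) (f : local_rule F F'),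
     (forall p q, (f (p, q)).2 = 0) /\ T = TM_of f].

Definition subgroup_of_RTM (H : set (tapes -> tapes)) :=
  [/\ H `<=` RTM, H id, forall g h, H g -> H h -> H (g \o h) &
      forall g h, H g -> cancel g h -> cancel h g -> H h].

Definition EL : set (tapes -> tapes) :=
  smallest subgroup_of_RTM (RFA `|` LP).

Definition shift (v : Zd d) (x : config) : config := fun u => x (u - v).

(* The default branch is never reached when T is a machine. *)
Definition Psi (T : tapes -> tapes) (z : config * 'I_k) : config * 'I_k :=
  let (x', y') := T (z.1, head_at z.2 0) in
  if find_head y' is Some (v, q') then (shift (- v) x', q') else z.

Definition is_shift_indicator (P : config * 'I_k -> config * 'I_k)
    (s : config * 'I_k -> Zd d) :=
  continuous (s : {ptws Zd d -> discrete_topology 'I_n} * discrete_topology 'I_k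
                  -> discrete_topology (Zd d))
  /\ exists a : nat, forall z u, a%:Z <= mx_norm u ->
       (P z).1 u = shift (s z) z.1 u.

Definition shift_indicator (P : config * 'I_k -> config * 'I_k) :
    config * 'I_k -> Zd d :=
  xget (fun=> 0) [set s | is_shift_indicator P s].

End Machines.

Arguments RTM : clear implicits.
Arguments RFA : clear implicits.
Arguments LP : clear implicits.
Arguments EL : clear implicits.

HB.instance Definition _ (n : nat) := isPointed.Build 'I_n.+1 ord0.

Section Bernoulli.
Variables (R : realType) (d n : nat).

Definition cylinder (D : {fset Zd d}) (p : D -> 'I_n.+1) : set (config d n.+1) :=
  [set x | forall u : D, x (val u) = p u].

Definition cylinders : set (set (Zd d -> 'I_n.+1)) :=
  [set C | exists (D : {fset Zd d}) (p : D -> 'I_n.+1), C = cylinder p].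

Definition mconfig := g_sigma_algebraType cylinders.

Definition is_bernoulli (m : probability mconfig R) :=
  forall (D : {fset Zd d}) (p : D -> 'I_n.+1),
    m (cylinder p) = ((n.+1%:R ^- #|` D|) : R)%:E.

(* Existence: the image of Lebesgue measure on [0, 1[ under the map sending a
   real number to its sequence of base n.+1 digits, reindexed by Zd d. *)
Local Notation N := n.+1.
Local Notation base := (N%:R : R).

Let trunc_scaled (m : nat) (x : R) : nat := Num.trunc (base ^+ m * x).
Let digit (j : nat) (x : R) : nat := (trunc_scaled j.+1 x %% N)%N.
Let digits (x : R) : config d N := fun u => inord (digit (choice.pickle u) x).

Let N0 m : 0 < base ^+ m. Proof. by rewrite exprn_gt0. Qed.

Let sc_ge0 m (x : R) : 0 <= x -> 0 <= base ^+ m * x.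
Proof. by move=> x0; rewrite mulr_ge0// ltW. Qed.

Let measurable_trunc m w : measurable [set x | trunc_scaled m x = w].
Proof.
have ml v : measurable [set x | (trunc_scaled m x <= v)%N].
  rewrite (_ : [set _ | _] = `]-oo, (v.+1%:R / base ^+ m)[%classic); first by [].
  apply/seteqP; split => x /=; rewrite in_itv/= /trunc_scaled truncn_le_nat;
    by rewrite ltr_pdivlMr// mulrC.
case: w => [|w].
  rewrite (_ : [set _ | _] = [set x | (trunc_scaled m x <= 0)%N])//.
  by apply/seteqP; split => x /=; rewrite leqn0 => /eqP.
rewrite (_ : [set _ | _] = [set x | (trunc_scaled m x <= w.+1)%N] `\`
   [set x | (trunc_scaled m x <= w)%N]); first exact: measurableD.
apply/seteqP; split => x /=; first by move=> ->; rewrite leqnn ltnn.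
by case=> h /negP; rewrite -ltnNge => h'; apply/eqP; rewrite eqn_leq h.
Qed.

Let measurable_digit j a : measurable [set x | digit j x = a].
Proof.
rewrite (_ : [set _ | _] = \bigcup_(w in [set w | w %% N = a]%N)
    [set x | trunc_scaled j.+1 x = w]).
  exact: bigcup_measurable.
apply/seteqP; split => x /=; first by move=> h; exists (trunc_scaled j.+1 x).
by case=> w /= <- ha; rewrite /digit ha.
Qed.

Let digitsE u x (a : 'I_N) : digits x u = a <-> digit (choice.pickle u) x = a.
Proof.
rewrite /digits; split => [<-|h]; first by rewrite inordK// ltn_mod.
by apply/val_inj; rewrite /= inordK ?h.
Qed.

Let measurable_digits :
  measurable_fun [set: R] (digits : R -> mconfig).
Proof.
apply: (@measurability _ _ _ mconfig _ _ cylinders) => //.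
move=> _ [_ [D [p ->]] <-]; rewrite setTI.
rewrite (_ : _ @^-1` _ = \bigcap_(u in [set: D])
    [set x | digit (choice.pickle (val u)) x = p u]).
  apply: fin_bigcap_measurable => //.
apply/seteqP; split => x /=.
  by move=> h u _; apply/(digitsE (val u) x (p u))/h.
by move=> h u; apply/(digitsE (val u) x (p u)); exact: h.
Qed.

Let sum_nat_mul K (F : nat -> nat) :
  (\sum_(0 <= w < K * N) F w = \sum_(0 <= v < K) \sum_(a < N) F (v * N + a))%N.
Proof.
elim: K => [|K IH]; first by rewrite !big_geq.
rewrite mulSnr big_nat_recr//= -IH (@big_cat_nat _ _ _ (K * N)%N) ?leq_addr//=.
congr addn; rewrite -{1}[(K * N)%N]add0n big_addn addKn big_mkord.
by apply: eq_bigr => a _; rewrite addnC.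
Qed.

Let ok (o : option 'I_N) (a : nat) := if o is Some b then a == b else true.

Section Constraint.
Variable c : nat -> option 'I_N.

Fixpoint digits_ok (m w : nat) : bool :=
  if m is m'.+1 then digits_ok m' (w %/ N)%N && ok (c m') (w %% N)%N else true.

Let cnt m := (\sum_(j < m) (c j != None))%N.

Let truncS m (x : R) : 0 <= x -> (trunc_scaled m.+1 x %/ N)%N = trunc_scaled m x.
Proof.
move=> x0; apply/esym/eqP; rewrite /trunc_scaled truncn_eq ?sc_ge0//.
set y := base ^+ m.+1 * x.
have -> : base ^+ m * x = y / base.
  by rewrite /y exprS -!mulrA mulrCA (mulrCA _ x) mulfV ?mulr1 ?pnatr_eq0.
have y0 : 0 <= y by exact: sc_ge0.
have /andP[h1 h2] := truncn_itv y0.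
rewrite ler_pdivlMr ?ltr_pdivrMr// -!natrM.
apply/andP; split; first by apply: le_trans h1; rewrite ler_nat leq_trunc_div.
by apply: lt_le_trans h2 _; rewrite ler_nat ltn_ceil.
Qed.

Let digits_okP m (x : R) : 0 <= x ->
  digits_ok m (trunc_scaled m x) <-> forall j, (j < m)%N -> ok (c j) (digit j x).
Proof.
move=> x0; elim: m => [|m IH]; first by [].
rewrite /= truncS//; split.
  case/andP => /IH h hm j; rewrite ltnS leq_eqVlt => /orP[/eqP->//|]; exact: h.
by move=> h; apply/andP; split; [apply/IH => j jm; apply: h; exact: ltnW|exact: h].
Qed.

Let sum_digits_ok m : (\sum_(w < N ^ m) digits_ok m w * N ^ cnt m = N ^ m)%N.
Proof.
rewrite -(big_mkord predT (fun w => digits_ok m w * N ^ cnt m)%N) -big_distrl/=.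
elim: m => [|m IH]; first by rewrite big_nat1 /cnt big_ord0.
rewrite {2}expnSr -IH expnSr sum_nat_mul.
under eq_bigr => v _.
  under eq_bigr => a _.
    rewrite [digits_ok _ _]/= divnMDl// modnMDl divn_small// addn0 modn_small//.
    rewrite -mulnb.
  over.
  rewrite -big_distrr.
over.
rewrite -big_distrl/= -!mulnA; congr (_ * _)%N.
have -> : cnt m.+1 = (cnt m + (c m != None))%N by rewrite /cnt big_ord_recr.
rewrite expnD mulnCA; congr (_ * _)%N.
case: (c m) => [b|] /=; last first.
  by rewrite sum_nat_const card_ord expn0 !muln1.
rewrite (bigD1 b)//= eqxx big1 ?addn0 ?mul1n ?expn1// => i /negbTE ib.
by rewrite -[_ == _]/(i == b) ib.
Qed.

Lemma lebesgue_digits_ok m : lebesgue_measure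
    (`[0, 1[%classic `&` [set x | forall j, (j < m)%N -> ok (c j) (digit j x)])
  = (base ^- (\sum_(j < m) (c j != None))%N)%:E.
Proof.
rewrite -/(cnt m).
pose I w : set R :=
  if digits_ok m w then `[w%:R / base ^+ m, w.+1%:R / base ^+ m[%classic else set0.
have mI w : measurable (I w) by rewrite /I; case: ifP.
have IE w x : I w x -> [/\ 0 <= x, trunc_scaled m x = w & digits_ok m w].
  rewrite /I; case: ifP => // gw /=; rewrite in_itv /= => /andP[h1 h2].
  have x0 : 0 <= x by apply: le_trans h1; rewrite divr_ge0//; exact/ltW/N0.
  split => //; apply/eqP; rewrite /trunc_scaled truncn_eq ?sc_ge0//.
  by move: h1 h2; rewrite ler_pdivrMr// ltr_pdivlMr// (mulrC x) => -> ->.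
rewrite (_ : _ `&` _ = \big[setU/set0]_(w < N ^ m) I w); last first.
  rewrite -(bigcup_mkord (N ^ m) I); apply/seteqP; split => x /=.
    rewrite in_itv/= => -[/andP[x0 x1] h]; exists (trunc_scaled m x) => /=.
      rewrite /trunc_scaled truncn_lt_nat ?sc_ge0//.
      by rewrite natrX gtr_pMr.
    rewrite /I ifT; last exact/digits_okP.
    have := @truncn_itv _ (base ^+ m * x).
    move=> /(_ (sc_ge0 _ x0)).
    by rewrite /= in_itv/= ler_pdivrMr// ltr_pdivlMr// (mulrC x).
  case=> w /= wN /IE[x0 tw gw]; split; last by apply/digits_okP => //; rewrite tw.
  rewrite in_itv/= x0/=.
  have := truncn_lt_nat (N ^ m) (mulr_ge0 (ltW (N0 m)) x0).
  by rewrite -/(trunc_scaled m x) tw wN => /esym; rewrite natrX gtr_pMr.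
rewrite measure_semi_additive_ord//=; last 3 first.
- by move=> i; exact: (mI i).
- apply/trivIsetP => i j _ _ ij; apply/seteqP; split => x //= [/IE[_ h _] /IE[_ h' _]].
  by move/eqP: ij; apply; apply/val_inj; exact: etrans (esym h) h'.
- by apply: bigsetU_measurable => i _; exact: (mI i).
transitivity (\sum_(w < N ^ m) ((digits_ok m w)%:R / base ^+ m)%:E)%E.
  apply: eq_bigr => w _; rewrite /I; case: ifP => _; last by rewrite measure0 mul0r.
  rewrite lebesgue_measure_itv/= lte_fin ltr_pM2r ?invr_gt0// ltr_nat ltnSn.
  by rewrite -EFinB -mulrBl -natrB// subSnn.
rewrite sumEFin; congr (_%:E).
rewrite -mulr_suml -natr_sum; apply/eqP.
rewrite -[X in _ == X]mul1r eqr_div ?lt0r_neq0// mul1r -!natrX -natrM big_distrl/=.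
by rewrite sum_digits_ok.
Qed.

End Constraint.

Lemma bernoulli_exists : exists m : probability mconfig R, is_bernoulli m.
Proof.
have mI : measurable (`[0, 1[%classic : set R) by [].
pose P := mnormalize (mrestr lebesgue_measure mI) point.
have PE (A : set R) : P A = lebesgue_measure (`[0, 1[ `&` A).
  have lI : mrestr lebesgue_measure mI [set: R] = 1%E.
    by rewrite /mrestr setTI lebesgue_measure_itv/= lte_fin ltr01 oppr0 adde0.
  rewrite /P /mnormalize [X in X == 0%E]lI [X in X == +oo%E]lI [X in fine X]lI/=.
  by rewrite onee_eq0/= invr1 mule1 /mrestr setIC.
pose TR := g_sigma_algebraType (R.-ocitv.-measurable).
pose X : {mfun TR >-> mconfig} :=
  HB.pack (digits : TR -> mconfig)
    (@isMeasurableFun.Build _ _ TR mconfig digits measurable_digits).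
exists (distribution P X) => D p.
transitivity (P (digits @^-1` cylinder p)); first by [].
rewrite PE.
pose c j := if [pick u : D | choice.pickle (val u) == j] is Some u
            then Some (p u) else None.
have cE (u : D) : c (choice.pickle (val u)) = Some (p u).
  rewrite /c; case: pickP => [v /eqP|/(_ u)]; last by rewrite eqxx.
  by move=> /(pcan_inj choice.pickleK)/val_inj ->.
pose M := (\max_(u : D) choice.pickle (val u)).+1.
have uM (u : D) : (choice.pickle (val u) < M)%N by rewrite ltnS leq_bigmax.
rewrite (_ : _ @^-1` _ = [set x | forall j, (j < M)%N -> ok (c j) (digit j x)]).
  rewrite lebesgue_digits_ok; congr ((_ ^- _)%:E).
  transitivity (\sum_(j < M) \sum_(u : D) (choice.pickle (val u) == j))%N.
    apply: eq_bigr => j _; rewrite /c; case: pickP => [u /eqP uj|h].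
      rewrite (bigD1 u)//= uj eqxx big1// => v vu; apply/eqP; rewrite eqb0.
      apply: contra vu => /eqP vj; apply/eqP/val_inj.
      by apply: (pcan_inj choice.pickleK); rewrite uj.
    by rewrite big1// => u _; rewrite h.
  rewrite exchange_big/= (eq_bigr (fun=> 1%N)) => [|u _].
    by rewrite sum1_card cardfE.
  rewrite (bigD1 (Ordinal (uM u)))//= eqxx big1// => j ju.
  by apply/eqP; rewrite eqb0; apply: contra ju => /eqP uj; apply/eqP/val_inj.
apply/seteqP; split => x /= h.
  move=> j _; rewrite /c; case: pickP => [u /eqP <-|//] /=.
  by apply/eqP/(digitsE (val u) x (p u)); exact: h.
move=> u; apply/(digitsE (val u) x (p u)).
by have := h _ (uM u); rewrite cE => /eqP.
Qed.

End Bernoulli.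

(* is_bernoulli determines the measure: the cylinders generate the sigma-algebra
   and, together with set0, are stable under intersection. *)
Definition bernoulli (R : realType) (d n : nat) : probability (mconfig d n) R :=
  sval (cid (bernoulli_exists R d n)).

Lemma bernoulliP (R : realType) (d n : nat) : is_bernoulli (bernoulli R d n).
Proof. exact: svalP (cid (bernoulli_exists R d n)). Qed.

Section AverageMovement.
Variables (R : realType) (d n k : nat).

Definition mstate := g_sigma_algebraType [set: set 'I_k.+1].

(* The second argument of mnormalize is a default value, used only when the
   total mass is 0 or +oo; here the total mass is k.+1. *)
Definition uniform_state : probability mstate R :=
  mnormalize (@counting mstate R) (dirac (point : mstate)).

Definition alpha (T : tapes d n.+1 k.+1 -> tapes d n.+1 k.+1) : 'rV[R]_d :=
  \row_i (\int[(bernoulli R d n \x uniform_state)%E]_z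
             (shift_indicator (Psi T) z 0 i)%:~R)%R.

End AverageMovement.

Arguments alpha : clear implicits.

Definition fraction_lattice (R : realType) (d p : nat) : set 'rV[R]_d :=
  [set v | forall i, exists m : int, v 0 i = m%:~R / p%:R].

Arguments fraction_lattice : clear implicits.

(* Main.v *)
(* The expected movement is additive under composition because Psi(T) permutes
   cylinders of equal measure, and it vanishes on LP; so it remains to compute it
   on RFA.  For a fixed tape x, an element of RFA acts on head positions and
   states by a permutation, and changing x in one cell changes this permutation
   only on a finite set, without changing its image: the total displacement over
   this set is the same for both tapes.  Randomizing the cells of the zero tape one
   after the other along a linear order of Z^d, this shows that the mean over x of
   the sum over q of the movements at (x, q) is its value at the zero tape, an
   integer vector.  A machine that carries along the symbol under its head, for one
   state and one symbol only, has average movement of norm 1/(nk). *)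
Require Import Defs.
From mathcomp Require Import all_boot all_order all_algebra finmap.
From mathcomp Require Import all_classical all_reals all_analysis.
From mathcomp Require Import measurable_realfun zify.
(* Imported again, as [shift] is shadowed by all_analysis. *)
Require Import Defs.
Set Implicit Arguments.
Unset Strict Implicit.
Unset Printing Implicit Defensive.
Import Order.TTheory GRing.Theory Num.Theory.
Local Open Scope classical_set_scope.
Local Open Scope ring_scope.

(** * Machines in local form *)

Section Machines.
Variables d n k : nat.
Implicit Types (x y : config d n) (q r : 'I_k) (v e : Zd d) (D : {fset Zd d}).
Implicit Types (h : headtrack d k) (T : tapes d n k -> tapes d n k).

Lemma head_at_inj q r v e : head_at q v = head_at r e -> q = r /\ v = e.
Proof.
move=> /(congr1 sval)/(congr1 (@^~ v))/=; rewrite eqxx.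
by case: eqP => [-> /lift_inj|].
Qed.

Lemma find_head_at q v : find_head (head_at q v) = Some (v, q).
Proof.
rewrite /find_head; case: pselect => [h|]; last first.
  by case; exists (v, q); rewrite /= eqxx.
case: (cid h) => -[e r] /=; case: eqP => [-> /lift_inj -> //|_].
by move=> /(congr1 val).
Qed.

Lemma find_headP h v q : find_head h = Some (v, q) -> h = head_at q v.
Proof.
rewrite /find_head; case: pselect => // ex [].
case: (cid ex) => -[e r] /= hr [? ?]; subst e r.
case: h hr {ex} => f fP /= fv; apply: eq_exist; apply/funext => t.
case: eqP => [->//|tv]; apply/eqP; apply: contraT => /eqP ft.
by case: tv; apply: fP => //; rewrite fv.
Qed.

Lemma shiftE v x u : shift v x u = x (u - v). Proof. by []. Qed.

Lemma shift0 x : shift 0 x = x.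
Proof. by apply/funext => u; rewrite shiftE subr0. Qed.

Lemma shiftD v e x : shift v (shift e x) = shift (v + e) x.
Proof. by apply/funext => u; rewrite !shiftE opprD addrA. Qed.

Lemma shiftK v x : shift (- v) (shift v x) = x.
Proof. by rewrite shiftD addNr shift0. Qed.

Lemma shiftNK v x : shift v (shift (- v) x) = x.
Proof. by rewrite shiftD addrN shift0. Qed.

Definition agree D x y := [forall u : D, x (val u) == y (val u)].

Lemma agreeP D x y : reflect (forall u, u \in D -> x u = y u) (agree D x y).
Proof.
apply: (iffP forallP) => h u; last by apply/eqP/h/valP.
by move=> uD; apply/eqP; exact: (h [` uD]%fset).
Qed.

Lemma agree_sub D D' x y :
  (D `<=` D')%fset -> agree D' x y -> agree D x y.
Proof. by move=> /fsubsetP DD /agreeP h; apply/agreeP => u /DD /h. Qed.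

(* [st (x, q)] is the triple (new tape, new state, move) produced from the tape
   [x] with head at the origin in state [q]. *)
Record machine D (st : config d n * 'I_k -> config d n * 'I_k * Zd d) T
    : Prop := Machine {
  machine_headless : forall x h, find_head h = None -> T (x, h) = (x, h);
  machine_head : forall x q v, T (shift v x, head_at q v) =
    (shift v (st (x, q)).1.1, head_at (st (x, q)).1.2 (v + (st (x, q)).2));
  machine_local : forall x y q, agree D x y ->
    [/\ (st (x, q)).1.2 = (st (y, q)).1.2, (st (x, q)).2 = (st (y, q)).2
      & agree D (st (x, q)).1.1 (st (y, q)).1.1];
  machine_out : forall z u, u \notin D -> (st z).1.1 u = z.1 u }.

Lemma is_TM_machine T : is_TM T -> exists D st, machine D st T.
Proof.
case=> F [F' [f ->]]; exists (F `|` F')%fset.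
(* The common window is [F] together with [F']: the rule reads on [F] and writes on [F']. *)
exists (fun z => let '(p, q, e) := f ([ffun u : F => z.1 (val u)], z.2) in
  (fun t => if insub t is Some w then p w else z.1 t, q, e)).
split => /=.
- by move=> x h /= ->.
- move=> x q v; rewrite find_head_at.
  have -> : [ffun u : F => shift v x (v + val u)] = [ffun u => x (val u)].
    by apply/ffunP => u; rewrite !ffunE shiftE addrC addKr.
  by case: (f _) => -[p' q'] e /=; congr pair.
- move=> x y q xy.
  have <- : [ffun u : F => x (val u)] = [ffun u => y (val u)].
    apply/ffunP => u; rewrite !ffunE; apply: (agreeP _ _ _ xy).
    by rewrite inE (valP u).
  case: (f _) => -[p' q'] e /=; split => //.
  apply/agreeP => u uD; case: insub => //; exact: (agreeP _ _ _ xy).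
- move=> z u; rewrite inE negb_or => /andP[_ uF'].
  by case: (f _) => -[p' q'] e /=; rewrite insubN.
Qed.

(** Coordinates for configurations with a head: [z] is what the head sees, [v] is where it stands.
    In them a machine is a skew product, [Psi] acting on [z] and [movement] being added to [v]. *)
Definition at_origin (z : config d n * 'I_k) v : tapes d n k :=
  (shift v z.1, head_at z.2 v).

Lemma at_origin_inj z z' v v' : at_origin z v = at_origin z' v' -> z = z' /\ v = v'.
Proof.
rewrite /at_origin; case: z z' => [x q] [x' q'] /= /pair_equal_spec[xx].
move=> /head_at_inj[-> vv]; subst v'.
by rewrite -(shiftK v x) xx shiftK.
Qed.

Lemma tapesP (t : tapes d n k) :
  (exists z v, t = at_origin z v) \/ (find_head t.2 = None).
Proof.
case: t => x h; case E: (find_head h) => [[v q]|]; last by right.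
left; exists (shift (- v) x, q), v.
by rewrite (find_headP E) /at_origin /= shiftNK.
Qed.

Definition movement T (z : config d n * 'I_k) : Zd d :=
  if find_head (T (at_origin z 0)).2 is Some (v, _) then v else 0.

Section MachineTheory.
Variables (D : {fset Zd d}) (st : config d n * 'I_k -> config d n * 'I_k * Zd d).
Variables (T : tapes d n k -> tapes d n k) (mT : machine D st T).

Lemma machine_at0 z : T (z.1, head_at z.2 0) = ((st z).1.1, head_at (st z).1.2 (st z).2).
Proof.
by case: z => x q; rewrite -{1}(shift0 x) (machine_head mT) shift0 add0r.
Qed.

Lemma machine_movement z : movement T z = (st z).2.
Proof.
by rewrite /movement /at_origin shift0 machine_at0 /= find_head_at.
Qed.

Lemma machine_Psi z : Psi T z = (shift (- (st z).2) (st z).1.1, (st z).1.2).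
Proof. by rewrite /Psi machine_at0 find_head_at. Qed.

Lemma machine_at_origin z v :
  T (at_origin z v) = at_origin (Psi T z) (v + movement T z).
Proof.
case: z => x q; rewrite machine_movement machine_Psi /at_origin.
by rewrite (machine_head mT) /= shiftD -addrA addrN addr0.
Qed.

End MachineTheory.

Lemma TM_at_origin T z v : is_TM T ->
  T (at_origin z v) = at_origin (Psi T z) (v + movement T z).
Proof. by move=> /is_TM_machine[D [st mT]]; exact: machine_at_origin mT z v. Qed.

Lemma TM_eq_at_origin T z z' e : is_TM T -> T (at_origin z 0) = at_origin z' e ->
  Psi T z = z' /\ movement T z = e.
Proof. by move=> hT; rewrite TM_at_origin// add0r => /at_origin_inj. Qed.

(** The cocycle identity of the skew product, from which additivity of [alpha] will follow. *)
Lemma Psi_movement_comp T T' z : is_TM T -> is_TM T' -> is_TM (T \o T') ->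
  Psi (T \o T') z = Psi T (Psi T' z) /\
  movement (T \o T') z = movement T' z + movement T (Psi T' z).
Proof.
by move=> hT hT' hTT'; apply: TM_eq_at_origin => //=; rewrite !TM_at_origin// add0r.
Qed.

Lemma PsiK T T' : is_TM T -> is_TM T' -> cancel T T' -> cancel (Psi T) (Psi T').
Proof.
move=> hT hT' TK z; have := TK (at_origin z 0).
by rewrite !TM_at_origin// => /at_origin_inj[].
Qed.

Lemma id_machine : machine fset0 (fun z => (z.1, z.2, 0)) (@id (tapes d n k)).
Proof. by split => //= x q v; rewrite addr0. Qed.

End Machines.

Arguments machine_out {d n k D st T} _ z u _.

(** * The group of reversible machines and preimages of cylinders *)

Section Rules.
Variables d n k : nat.
Implicit Types (x y : config d n.+1) (q r : 'I_k) (v e : Zd d) (D : {fset Zd d}).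
Implicit Types (T : tapes d n.+1 k -> tapes d n.+1 k).

Definition extend D (p : {ffun D -> 'I_n.+1}) : config d n.+1 :=
  fun t => if insub t is Some u then p u else ord0.

Lemma extendE D (p : {ffun D -> 'I_n.+1}) (u : D) : extend p (val u) = p u.
Proof. by rewrite /extend valK. Qed.

Lemma agree_extend D x : agree D x (extend [ffun u : D => x (val u)]).
Proof. by apply/forallP => u; rewrite extendE ffunE. Qed.

Definition machine_rule D (st : config d n.+1 * 'I_k -> config d n.+1 * 'I_k * Zd d) :
    local_rule n.+1 k D D :=
  fun pq => let '(x, q, e) := st (extend pq.1, pq.2) in
    ([ffun u : D => x (val u)], q, e).

(** Locality lets the tape be replaced by the canonical extension of its pattern on [D], and off [D]
    nothing is written, so a rule on patterns suffices. *)
Lemma machine_is_TM_of D st T : machine D st T -> T = TM_of (@machine_rule D st).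
Proof.
move=> mT; apply/funext => -[x h]; rewrite /TM_of.
case E: (find_head h) => [[v q]|]; last exact: (machine_headless mT).
rewrite (find_headP E) -(shiftNK v x) (machine_head mT).
set x0 := shift (- v) x; rewrite /machine_rule /=.
have -> : [ffun u : D => shift v x0 (v + val u)] = [ffun u => x0 (val u)].
  by apply/ffunP => u; rewrite !ffunE shiftE addrC addKr.
have [] := machine_local mT q (agree_extend D x0).
move: (machine_out mT (x0, q)).
case: (st (x0, q)) => -[x1 q1] e1 /= out.
case: (st _) => -[x2 q2] e2 /= -> -> /agreeP x12; congr pair.
apply/funext => t; case: insubP => [w wD wt|tD].
  by rewrite ffunE wt -x12// shiftE.
by rewrite !shiftE -[RHS]out.
Qed.

Lemma machine_is_TM D st T : machine D st T -> is_TM T.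
Proof. by move=> /machine_is_TM_of ->; exists D, D, (@machine_rule D st). Qed.


Lemma id_is_TM : is_TM (@id (tapes d n.+1 k)).
Proof. exact: machine_is_TM (@id_machine _ _ _). Qed.

(** The move depends only on the state and the pattern on [D], of which there are finitely many. *)
Lemma machine_moves D st T : machine D st T ->
  exists E : {fset Zd d}, forall z : config d n.+1 * 'I_k, (st z).2 \in E.
Proof.
move=> mT.
exists [fset (st (extend pq.1, pq.2)).2 | pq : {ffun D -> 'I_n.+1} * 'I_k]%fset.
case=> x q; apply/imfsetP.
exists ([ffun u : D => x (val u)], q) => //=.
by have [] := machine_local mT q (agree_extend D x).
Qed.

Lemma TM_comp T T' : is_TM T -> is_TM T' -> is_TM (T \o T').
Proof.
move=> /is_TM_machine[D [st mT]] /is_TM_machine[D' [st' mT']].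
have [E mE] := machine_moves mT'.
pose st'' z := let '(x, q, e) := st' z in
  let '(x', q', e') := st (shift (- e) x, q) in (shift e x', q', e + e').
(* After [T'] has moved by some element of [E], the window of [T] lies at [D] translated by that
   element. *)
pose D'' := (D' `|` [fset (u + e)%R | u in D, e in E])%fset.
have D''P z u : u - (st' z).2 \in D -> u \in D''.
  move=> uD; rewrite inE; apply/orP; right; apply/imfset2P.
  by exists (u - (st' z).2) => //; exists (st' z).2; rewrite ?mE// subrK.
apply: (@machine_is_TM D'' st''); split.
- move=> x h hN /=; rewrite (machine_headless mT')//.
  exact: (machine_headless mT).
- move=> x q v /=; rewrite (machine_head mT') /st''.
  case: (st' _) => -[x1 q1] e1 /=.
  rewrite -{1}(shiftNK e1 x1) shiftD (machine_head mT).
  by case: (st _) => -[x2 q2] e2 /=; rewrite shiftD addrA.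
- move=> x y q xy; rewrite /st''.
  have [] := machine_local mT' q (agree_sub (fsubsetUl _ _) xy).
  have := D''P (x, q).
  move: (machine_out mT' (x, q)) (machine_out mT' (y, q)).
  case: (st' (x, q)) => -[x1 q1] e1; case: (st' (y, q)) => -[y1 q1'] e1' /=.
  move=> x1x y1y D''e <- <- /agreeP xy1 {q1' e1'}.
  have xy1'' : agree D'' x1 y1.
    apply/agreeP => u uD; have [uD'|uD'] := boolP (u \in D'); first exact: xy1.
    by rewrite x1x// y1y//; exact: (agreeP _ _ _ xy).
  have xyD : agree D (shift (- e1) x1) (shift (- e1) y1).
    apply/agreeP => u uD; rewrite !shiftE opprK; apply: (agreeP _ _ _ xy1'').
    by apply: D''e; rewrite addrK.
  have [] := machine_local mT q1 xyD.
  move: (machine_out mT (shift (- e1) x1, q1)) (machine_out mT (shift (- e1) y1, q1)).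
  case: (st _) => -[x2 q2] e2; case: (st _) => -[y2 q2'] e2' /=.
  move=> x2x y2y -> -> /agreeP xy2; split => //.
  apply/agreeP => u uD; rewrite !shiftE.
  have [ueD|ueD] := boolP (u - e1 \in D); first exact: xy2.
  rewrite x2x// y2y// !shiftE opprK subrK; exact: (agreeP _ _ _ xy1'').
- move=> z u; rewrite /st''; have := D''P z u.
  move: (machine_out mT' z u); case: (st' z) => -[x1 q1] e1 /=.
  move: (machine_out mT (shift (- e1) x1, q1) (u - e1)).
  case: (st _) => -[x2 q2] e2 /= x2x x1z Du uD.
  rewrite shiftE x2x ?shiftE ?opprK ?subrK ?x1z//; last exact: contra Du _.
  by apply: contra uD; rewrite inE => ->.
Qed.

Lemma RTM_subgroup : subgroup_of_RTM (RTM d n.+1 k).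
Proof.
split => //.
- by split; [exact: id_is_TM | exists id; split => //; exact: id_is_TM].
- move=> g h [hg [g' [hg' gK g'K]]] [hh [h' [hh' hK h'K]]].
  split; first exact: TM_comp.
  by exists (h' \o g'); split; [exact: TM_comp | exact: can_comp | exact: can_comp].
- move=> g h [hg [g' [hg' gK g'K]]] ghK hgK.
  have -> : h = g'.
    by apply/funext => t; rewrite -[t in RHS]hgK gK.
  by split => //; exists g.
Qed.

Lemma EL_sub_RTM : EL d n.+1 k `<=` RTM d n.+1 k.
Proof.
apply: smallest_sub; first exact: RTM_subgroup.
by move=> T [[]|[]].
Qed.

(* On a cylinder containing its window, the inverse machine always rewrites the
   window in the same way and makes the same move [e]. *)
Lemma Psi_preimage_cylinder T : RTM d n.+1 k T -> exists D : {fset Zd d},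
  forall (H : {fset Zd d}) w r, (D `<=` H)%fset -> exists e w' r', forall z,
    agree H (Psi T z).1 w && ((Psi T z).2 == r) =
    agree [fset (u - e)%R | u in H]%fset z.1 w' && (z.2 == r').
Proof.
case=> hT [T' [hT' TK T'K]].
have PK := PsiK hT hT' TK; have P'K := PsiK hT' hT T'K.
(* The window is that of the inverse: running [T'] from the target cylinder describes the states
   that reach it. *)
have [D [st mT]] := is_TM_machine hT'; exists D => H w r DH.
have stP y : agree H y w -> [/\ (st (y, r)).1.2 = (st (w, r)).1.2,
   (st (y, r)).2 = (st (w, r)).2 & agree H (st (y, r)).1.1 (st (w, r)).1.1].
  move=> yw; have [-> -> yw'] := machine_local mT r (agree_sub DH yw); split => //.
  apply/agreeP => u uH; have [uD|uD] := boolP (u \in D).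
    exact: (agreeP _ _ _ yw').
  by rewrite !(machine_out mT)//; exact: (agreeP _ _ _ yw).
move: stP; case Ew: (st (w, r)) => [[w' r'] e] /= stP.
exists e, (shift (- e) w'), r' => z.
apply/idP/idP => /andP[/agreeP a /eqP b].
  rewrite -(PK z); case E: (Psi T z) a b => [y s] /= /agreeP yw ?; subst s.
  have [h1 h2 /agreeP h3] := stP _ yw.
  rewrite (machine_Psi mT) h1 h2 eqxx andbT; apply/agreeP => _ /imfsetP[u /= uH ->].
  by rewrite !shiftE opprK subrK h3.
(* The candidate image of [z]: the inverse writes only on [D], so [y] must be [z] moved back by [e]
   off [D], and it is prescribed as [w] on [D]. *)
pose y t := if t \in D then w t else shift e z.1 t.
have zw u : u \in H -> shift e z.1 u = w' u.
  move=> uH; rewrite shiftE a ?shiftE ?opprK ?subrK//.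
  by apply/imfsetP; exists u.
have yw : agree H y w.
  apply/agreeP => u uH; rewrite /y; case: ifPn => // uD; rewrite zw//.
  by have := machine_out mT (w, r) u uD; rewrite Ew.
have [h1 h2 /agreeP h3] := stP _ yw.
have -> : z = Psi T' (y, r).
  rewrite (machine_Psi mT) h1 h2 (surjective_pairing z) b; congr pair.
  rewrite -[LHS](shiftK e); congr shift.
  apply/funext => u; have [uD|uD] := boolP (u \in D).
    by have uH := fsubsetP DH _ uD; rewrite zw// h3.
  by rewrite (machine_out mT)//= /y (negbTE uD).
by rewrite P'K yw eqxx.
Qed.

End Rules.

(** * Shift indicators *)

Lemma near_const_continuous (X : topologicalType) (Y : choiceType)
    (s : X -> discrete_topology Y) :
  continuous s <-> forall x, \forall y \near x, s y = s x.
Proof.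
split => h x.
  exact: (proj1 (@discrete_cvg (discrete_topology Y) (s @ x) (s x) _) (h x)).
exact: (proj2 (@discrete_cvg (discrete_topology Y) (s @ x) (s x) _) (h x)).
Qed.

Lemma mx_norm_ge (K : realDomainType) m p (A : 'M[K]_(m, p)) i j :
  `|A i j| <= mx_norm A.
Proof. by rewrite mx_normrE (le_bigmax _ (fun ij => `|A ij.1 ij.2|) (i, j)). Qed.

Section ShiftIndicator.
Variables d n k : nat.
Local Notation state := (config d.+1 n.+2 * 'I_k)%type.
Local Notation tstate := ({ptws Zd d.+1 -> discrete_topology 'I_n.+2} *
  discrete_topology 'I_k)%type.

(** Fixing finitely many cells and the state is an open condition in the product topology. *)
Lemma local_continuous (D : {fset Zd d.+1}) (s : state -> Zd d.+1) :
  (forall x y q, agree D x y -> s (x, q) = s (y, q)) ->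
  continuous (s : tstate -> discrete_topology (Zd d.+1)).
Proof.
move=> sD; apply/near_const_continuous => -[x q].
have nx : \forall y \near (x : {ptws Zd d.+1 -> discrete_topology 'I_n.+2}),
    forall u : D, y (val u) = x (val u).
  apply: (@filter_forall _ D (fun u y => y (val u) = x (val u)) _
    (@nbhs_filter {ptws Zd d.+1 -> discrete_topology 'I_n.+2} x)) => u.
  exact: (@proj_continuous _ (fun _ : Zd d.+1 => discrete_topology 'I_n.+2)
            (val u) x _ (discrete_set1 _)).
have nq : nbhs (q : discrete_topology 'I_k) [set q] by exact: discrete_set1.
exists ([set y | forall u : D, y (val u) = x (val u)], [set q]) => //=.
move=> [y r] /= [yx ->]; apply: sD.
by apply/forallP => u; rewrite yx.
Qed.

(** If [s] and [s'] differ at [(x, q)], changing one very distant cell of [x] alters neither value,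
    by continuity, but makes the two shifted tapes disagree at a distant position. *)
Lemma shift_indicator_unique (P : state -> state) s s' :
  is_shift_indicator P s -> is_shift_indicator P s' -> s = s'.
Proof.
move=> [sc [a sa]] [s'c [a' s'a]]; apply/funext => -[x q].
apply/eqP; apply: contraT => /eqP ss'.
set b := s (x, q) in ss'; set b' := s' (x, q) in ss'.
pose far N : Zd d.+1 := const_mx N%:Z.
pose flip (c : 'I_n.+2) : 'I_n.+2 := if c == ord0 then ord_max else ord0.
have flipP c : flip c != c by rewrite /flip; case: (eqVneq c ord0) => [->//|]; rewrite eq_sym.
(* At position [far N] the shifts by [b] and [b'] read the cells [far N - b] and [far N - b'];
   [flip] forces these two symbols to differ. *)
pose y N : config d.+1 n.+2 :=
  fun t => if t == far N - b then flip (x (far N - b')) else x t.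
have yx : y @ \oo --> (x : {ptws Zd d.+1 -> discrete_topology 'I_n.+2}).
  apply: (proj2 (@pointwise_cvgP (discrete_topology (Zd d.+1))
    (discrete_topology 'I_n.+2) (y @ \oo) x _)) => t.
  apply: (proj2 (@discrete_cvg (discrete_topology 'I_n.+2) ((fun N => y N t) @ \oo) (x t) _)).
  (* From this index on, the first coordinate separates [t] from the altered cell. *)
  exists (absz (((t : Zd d.+1) + b)%R 0 0)).+1 => // N /= Nt.
  rewrite /y; case: eqP => // tE.
  move: Nt; rewrite tE subrK /far mxE; lia.
have y_near (s0 : state -> Zd d.+1) :
    continuous (s0 : tstate -> discrete_topology (Zd d.+1)) ->
    \forall N \near \oo, s0 (y N, q) = s0 (x, q).
  move=> /near_const_continuous/(_ (x, q))[[A B]] /= [/yx nA nB] AB.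
  apply: (@filterS nat \oo _ (fun N => A (y N)) _ _ nA) => N AN.
  by apply: (AB (y N, q)); split => //; exact: nbhs_singleton.
have [N [sN s'N aN a'N]] : exists N, [/\ s (y N, q) = b, s' (y N, q) = b',
    (a <= N)%N & (a' <= N)%N].
  near \oo => N; exists N; split.
  - by near: N; exact: y_near.
  - by near: N; exact: y_near.
  - by near: N; exact: nbhs_infty_ge.
  - by near: N; exact: nbhs_infty_ge.
have nfar (c : nat) : (c <= N)%N -> c%:Z <= mx_norm (far N).
  move=> cN; apply: (@le_trans _ _ `|far N 0 0|); first by rewrite mxE; lia.
  exact: mx_norm_ge.
have := sa (y N, q) (far N) (nfar _ aN).
rewrite (s'a _ _ (nfar _ a'N)) sN s'N !shiftE /= /y eqxx.
case: eqP => [/addrI /oppr_inj bb'|_]; first by case: ss'; rewrite bb'.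
by move=> /esym/eqP; rewrite (negbTE (flipP _)).
Unshelve. all: by end_near.
Qed.

(** Seen from the head, a move by [v] shifts the tape by [- v]; hence the sign. *)
Lemma shift_indicator_TM (T : tapes d.+1 n.+2 k -> tapes d.+1 n.+2 k) :
  is_TM T -> shift_indicator (Psi T) = fun z => - movement T z.
Proof.
move=> /is_TM_machine[D [st mT]].
suff sT : is_shift_indicator (Psi T) (fun z => - movement T z).
  apply: (shift_indicator_unique _ sT).
  exact: (@xgetPex _ (fun=> 0) [set s | is_shift_indicator (Psi T) s] (ex_intro _ _ sT)).
split.
  apply: (@local_continuous D) => x y q xy; rewrite !(machine_movement mT).
  by have [_ -> _] := machine_local mT q xy.
have [E mE] := machine_moves mT.
(* These are the only positions, relative to the new head, where the tape may have been rewritten;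
   the bound is one more than the largest norm among them. *)
pose G := [fset (u - e)%R | u in D, e in E]%fset.
exists (\max_(g : G) `|mx_norm (val g)|%N).+1 => z u ua.
rewrite (machine_Psi mT) (machine_movement mT) /= !shiftE opprK.
rewrite (machine_out mT)//; apply: contraL ua => uD.
have uG : u \in G.
  by apply/imfset2P; exists (u + (st z).2) => //; exists (st z).2; rewrite ?mE// addrK.
have := @leq_bigmax _ (fun g : G => `|mx_norm (val g)|%N) [` uG]%fset.
by rewrite /=; lia.
Qed.

End ShiftIndicator.

(** * Expectation of local functions *)

Lemma integrable_indic_lty dsp (T : measurableType dsp) (R : realType)
    (m : {measure set T -> \bar R}) (A : set T) :
  measurable A -> (m A < +oo)%E -> m.-integrable [set: T] (EFin \o \1_A).
Proof.
move=> mA mAoo; apply/integrableP; split.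
  exact/measurable_EFinP/measurable_indic.
rewrite (eq_integral (EFin \o \1_A)); last by move=> z _; rewrite /= ger0_norm.
by rewrite integral_indic// setIT.
Qed.

Section Expectation.
Variables (R : realType) (d n k : nat).
Local Notation state := (config d n.+1 * 'I_k.+1)%type.
Implicit Types (D : {fset Zd d}) (w : config d n.+1) (q : 'I_k.+1) (g : state -> R).

Local Notation mu := (bernoulli R d n \x uniform_state R k)%E.

Definition expect (g : state -> R) : R := \int[mu]_z g z.

Definition has_expect (g : state -> R) := mu.-integrable [set: _] (EFin \o g).

Definition cyl D w q (z : state) : R := (agree D z.1 w && (z.2 == q))%:R.

Lemma uniform_state1 q : uniform_state R k [set q] = (k.+1%:R^-1)%:E.
Proof.
have cE (A : set (mstate k)) : counting A = (#|` fset_set A|%:R)%:E :> \bar R.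
  by rewrite /counting asboolT//; exact: (@finite_finset 'I_k.+1).
have cT : #|` fset_set [set: mstate k]| = k.+1.
  transitivity (size (enum 'I_k.+1)); last exact: size_enum_ord.
  rewrite -(undup_id (enum_uniq 'I_k.+1)) -(size_seq_fset tt).
  apply/perm_size/uniq_perm => // x.
  rewrite seq_fsetE mem_enum in_fset_set; first exact: mem_set.
  exact: (@finite_finset 'I_k.+1).
rewrite /uniform_state /= /mnormalize /= -/(mstate k) !cE cT.
rewrite eqe pnatr_eq0 /=.
by rewrite cE (@fset_set1 (mstate k)) cardfs1 mul1e.
Qed.

Lemma cyl_mu D w q : let A : set (mconfig d n * mstate k) :=
    [set z | agree D z.1 w && (z.2 == q)] in
  measurable A /\ mu A = (n.+1%:R ^- #|` D| / k.+1%:R)%:E.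
Proof.
move=> A.
have -> : A = cylinder (fun u : D => w (val u)) `*` [set q].
  apply/seteqP; split => z /=.
    by move=> /andP[/forallP zw /eqP ->]; split => // u; apply/eqP.
  by move=> [zw zq]; apply/andP; split; [apply/forallP => u; apply/eqP/zw | exact/eqP].
have mC : measurable (cylinder (fun u : D => w (val u)) : set (mconfig d n)).
  by apply: sub_gen_smallest; exists D, (fun u : D => w (val u)).
have mq : measurable ([set q] : set (mstate k)) by exact: sub_gen_smallest.
split; first exact: measurableX.
rewrite product_measure1E//.
rewrite EFinM; congr (_ * _)%E; first exact: bernoulliP.
exact: uniform_state1.
Qed.

Lemma cylE D w q : cyl D w q = \1_[set z : state | agree D z.1 w && (z.2 == q)].
Proof.
apply/funext => z; rewrite /cyl indicE; congr (nat_of_bool _)%:R.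
by apply/idP/idP; rewrite ?in_setE// => /set_mem.
Qed.

Lemma has_expect_cyl D w q : has_expect (cyl D w q).
Proof.
have [mA muA] := cyl_mu D w q.
rewrite /has_expect cylE; apply: integrable_indic_lty mA _.
by rewrite [X in (X < _)%E]muA ltry.
Qed.

Lemma expect_cyl D w q : expect (cyl D w q) = n.+1%:R ^- #|` D| / k.+1%:R.
Proof.
have [mA muA] := cyl_mu D w q.
rewrite /expect /Rintegral cylE integral_indic// setIT.
by rewrite [X in fine X]muA.
Qed.

Lemma has_expectD f g : has_expect f -> has_expect g -> has_expect (f \+ g).
Proof.
move=> hf hg; rewrite /has_expect (_ : _ \o _ = (EFin \o f) \+ (EFin \o g))%E//.
exact: integrableD.
Qed.

Lemma has_expectZ (a : R) g : has_expect g -> has_expect (fun z => a * g z).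
Proof.
move=> hg; rewrite /has_expect (_ : _ \o _ = fun z => a%:E * (EFin \o g) z)%E//.
exact: integrableZl.
Qed.

Lemma expectD f g : has_expect f -> has_expect g ->
  expect (f \+ g) = expect f + expect g.
Proof. by move=> hf hg; rewrite /expect RintegralD. Qed.

Lemma expectZ (a : R) g : has_expect g -> expect (fun z => a * g z) = a * expect g.
Proof. by move=> hg; rewrite /expect RintegralZl. Qed.

Lemma expect_sum (I : finType) (a : I -> R) (f : I -> state -> R) :
  (forall i, has_expect (f i)) ->
  has_expect (fun z => \sum_i a i * f i z) /\
  expect (fun z => \sum_i a i * f i z) = \sum_i a i * expect (f i).
Proof.
move=> hf; elim: (index_enum I) => [|i s [hs Es]].
  under [X in has_expect X]eq_fun do rewrite big_nil.
  under [X in expect X]eq_fun do rewrite big_nil.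
  rewrite big_nil; split; first exact: integrable0.
  by rewrite /expect /Rintegral integral0.
under [X in has_expect X]eq_fun do rewrite big_cons.
under [X in expect X]eq_fun do rewrite big_cons.
have hi := has_expectZ (a i) (hf i).
by rewrite big_cons -Es -expectZ// -expectD//; split => //; exact: has_expectD.
Qed.

Definition local_on D g := forall x y q, agree D x y -> g (x, q) = g (y, q).

(** Exactly one cylinder over [D] contains [z], and [g] is constant on it. *)
Lemma local_on_sum D g z : local_on D g ->
  g z = \sum_(pq : {ffun D -> 'I_n.+1} * 'I_k.+1)
          g (extend pq.1, pq.2) * cyl D (extend pq.1) pq.2 z.
Proof.
case: z => x q gD; rewrite (bigD1 ([ffun u : D => x (val u)], q))//= big1.
  by rewrite addr0 /cyl agree_extend eqxx mulr1; apply: gD; exact: agree_extend.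
move=> [p r] /= pq; rewrite /cyl; case: andP => [[/= xp /eqP qr]|_]; last first.
  by rewrite mulr0.
case/eqP: pq; rewrite qr; congr pair; apply/ffunP => u; rewrite ffunE.
by rewrite -extendE (agreeP _ _ _ xp)// (valP u).
Qed.

Lemma expect_local D g : local_on D g -> has_expect g /\
  expect g = (\sum_(pq : {ffun D -> 'I_n.+1} * 'I_k.+1) g (extend pq.1, pq.2)) *
    (n.+1%:R ^- #|` D| / k.+1%:R).
Proof.
move=> gD.
have gE : g = fun z => \sum_(pq : {ffun D -> 'I_n.+1} * 'I_k.+1)
    g (extend pq.1, pq.2) * cyl D (extend pq.1) pq.2 z.
  by apply/funext => z; exact: local_on_sum.
have [] := @expect_sum _ (fun pq => g (extend pq.1, pq.2))
  (fun pq : {ffun D -> 'I_n.+1} * 'I_k.+1 => cyl D (extend pq.1) pq.2).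
  by move=> pq; exact: has_expect_cyl.
rewrite -gE => h ->; split => //; rewrite mulr_suml; apply: eq_bigr => pq _.
by rewrite expect_cyl.
Qed.

Lemma has_expect_local D g : local_on D g -> has_expect g.
Proof. by move=> /expect_local[]. Qed.

Lemma local_on_sub D D' g : (D `<=` D')%fset -> local_on D g -> local_on D' g.
Proof. by move=> DD' gD x y q xy; apply: gD; exact: agree_sub xy. Qed.

(** The measure is invariant under [Psi T]: the preimage of a cylinder over a large window is a
    cylinder over a translate of that window, with equally many cells and so equal mass. *)
Lemma expect_Psi T D g : RTM d n.+1 k.+1 T -> local_on D g ->
  has_expect (g \o Psi T) /\ expect (g \o Psi T) = expect g.
Proof.
move=> hT /local_on_sub gD; have [D' TD'] := Psi_preimage_cylinder hT.
have {}gD : local_on (D `|` D')%fset g by apply: gD; exact: fsubsetUl.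
set H := (D `|` D')%fset in gD; have D'H : (D' `<=` H)%fset by exact: fsubsetUr.
pose I : finType := ({ffun H -> 'I_n.+1} * 'I_k.+1)%type.
have gE : g \o Psi T = fun z =>
    \sum_(pq : I) g (extend pq.1, pq.2) * cyl H (extend pq.1) pq.2 (Psi T z).
  by apply/funext => z; exact: (local_on_sum (Psi T z) gD).
have cylP (pq : I) : has_expect (cyl H (extend pq.1) pq.2 \o Psi T) /\
    expect (cyl H (extend pq.1) pq.2 \o Psi T) = n.+1%:R ^- #|` H| / k.+1%:R.
  have [e [w [r Tw]]] := TD' H (extend pq.1) pq.2 D'H.
  rewrite (_ : _ \o _ = cyl [fset (u - e)%R | u in H]%fset w r).
    split; first exact: has_expect_cyl.
    rewrite expect_cyl card_imfset//; exact: addIr.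
  by apply/funext => z; rewrite /cyl /= Tw.
have [h hE] := @expect_sum I (fun pq => g (extend pq.1, pq.2))
  (fun pq => cyl H (extend pq.1) pq.2 \o Psi T) (fun pq => proj1 (cylP pq)).
rewrite gE; split => //; rewrite hE (proj2 (expect_local gD)) mulr_suml.
by apply: eq_bigr => pq _; rewrite (proj2 (cylP pq)).
Qed.

End Expectation.

(** * Two families of reversible machines *)

Section Examples.
Variables d n k : nat.
Local Notation state := (config d n.+1 * 'I_k)%type.
Implicit Types (x y : config d n.+1) (D : {fset Zd d}) (e : Zd d).

Definition run (st : state -> config d n.+1 * 'I_k * Zd d)
    (t : tapes d n.+1 k) : tapes d n.+1 k :=
  if find_head t.2 is Some (v, q) then
    let '(x, r, e) := st (shift (- v) t.1, q) in (shift v x, head_at r (v + e))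
  else t.

Lemma run_machine D st :
  (forall x y q, agree D x y ->
    [/\ (st (x, q)).1.2 = (st (y, q)).1.2, (st (x, q)).2 = (st (y, q)).2
      & agree D (st (x, q)).1.1 (st (y, q)).1.1]) ->
  (forall z u, u \notin D -> (st z).1.1 u = z.1 u) ->
  machine D st (run st).
Proof.
move=> loc out; split => //.
  by move=> x h hN; rewrite /run /= hN.
move=> x q v; rewrite /run /= find_head_at shiftK.
by case: (st _) => -[].
Qed.

(** In the skew product coordinates, inverting the action on what the head sees and cancelling the
    displacement can be checked separately. *)
Lemma machine_cancel D D' st st' (T T' : tapes d n.+1 k -> tapes d n.+1 k) :
  machine D st T -> machine D' st' T' -> cancel (Psi T) (Psi T') ->
  (forall z, movement T z + movement T' (Psi T z) = 0) -> cancel T T'.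
Proof.
move=> mT mT' PK mv t; have [[z [v ->]]|tN] := tapesP t.
  by rewrite (machine_at_origin mT) (machine_at_origin mT') PK -addrA mv addr0.
case: t tN => x h /= hN.
by rewrite (machine_headless mT)// (machine_headless mT').
Qed.

Definition walk_step (mv : 'I_k -> Zd d) (z : state) := (z.1, z.2, mv z.2).

Definition walk (mv : 'I_k -> Zd d) := run (walk_step mv).

Lemma walk_machine (mv : 'I_k -> Zd d) : machine fset0 (walk_step mv) (walk mv).
Proof. by apply: run_machine. Qed.

Lemma Psi_walk (mv : 'I_k -> Zd d) z : Psi (walk mv) z = (shift (- mv z.2) z.1, z.2).
Proof. exact: machine_Psi (walk_machine mv) z. Qed.

Lemma movement_walk (mv : 'I_k -> Zd d) z : movement (walk mv) z = mv z.2.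
Proof. exact: machine_movement (walk_machine mv) z. Qed.

Lemma walkK mv : cancel (walk mv) (walk (\- mv)).
Proof.
apply: machine_cancel (walk_machine mv) (walk_machine _) _ _ => z.
  by rewrite !Psi_walk /= shiftK -surjective_pairing.
by rewrite !movement_walk Psi_walk /= addrN.
Qed.

Lemma RTM_walk mv : RTM d n.+1 k (walk mv).
Proof.
split; first exact: machine_is_TM (walk_machine mv).
exists (walk (\- mv)); split; [exact: machine_is_TM (walk_machine _)|exact: walkK|].
rewrite -{2}(_ : \- (\- mv) = mv); first exact: walkK.
by apply/funext => q /=; rewrite opprK.
Qed.

Lemma RFA_walk mv : RFA d n.+1 k (walk mv).
Proof.
split; first exact: RTM_walk.
exists fset0, (@machine_rule _ _ _ fset0 (walk_step mv)); split.
  move=> p q; exists q, (mv q); rewrite /machine_rule /=; congr (_, _, _).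
  by apply/ffunP => u; rewrite ffunE extendE.
exact: machine_is_TM_of (walk_machine mv).
Qed.

Definition swap_cell e x : config d n.+1 :=
  fun t => x (if t == 0 then e else if t == e then 0 else t).

(* In state [q0] a head reading [a] carries that symbol along by [e]; the
   displaced symbol takes its place. *)
Definition carry_step (q0 : 'I_k) (a : 'I_n.+1) e (z : state) :
    config d n.+1 * 'I_k * Zd d :=
  if (z.2 == q0) && (z.1 0 == a) then (swap_cell e z.1, z.2, e) else (z, 0).

Definition carry q0 a e := run (carry_step q0 a e).

Lemma carry_machine q0 a e :
  machine [fset 0; e]%fset (carry_step q0 a e) (carry q0 a e).
Proof.
apply: run_machine => [x y q /agreeP xy|[x q] u]; rewrite /carry_step /=.
  have x0 : x 0 = y 0 by apply: xy; rewrite !inE eqxx.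
  rewrite -x0; case: ifP => _; split => //; apply/agreeP => u uD; rewrite /swap_cell /=.
    case: ifP => _; first by apply: xy; rewrite !inE eqxx orbT.
    by case: ifP => _ //; exact: xy.
  exact: xy.
rewrite !inE negb_or /swap_cell => /andP[/negbTE u0 /negbTE ue].
by case: ifP => //=; rewrite u0 ue.
Qed.

Lemma movement_carry q0 a e z :
  movement (carry q0 a e) z = if (z.2 == q0) && (z.1 0 == a) then e else 0.
Proof.
by rewrite (machine_movement (carry_machine q0 a e)) /carry_step; case: ifP.
Qed.

Lemma Psi_carry q0 a e z : Psi (carry q0 a e) z =
  if (z.2 == q0) && (z.1 0 == a) then (shift (- e) (swap_cell e z.1), z.2) else z.
Proof.
rewrite (machine_Psi (carry_machine q0 a e)) /carry_step; case: ifP => //= _.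
by rewrite oppr0 shift0 -surjective_pairing.
Qed.

Lemma swap_cellK e x : 
  shift e (swap_cell (- e) (shift (- e) (swap_cell e x))) = x.
Proof.
apply/funext => t; rewrite /swap_cell !shiftE opprK subr_eq0.
rewrite -[X in t - e == X]add0r (inj_eq (addIr _)).
have [->|te] := eqVneq t e; first by rewrite addNr eqxx.
have [->|t0] := eqVneq t 0; last by rewrite subrK (negbTE t0) (negbTE te).
by rewrite add0r; have [->|] := eqVneq e 0; rewrite ?eqxx.
Qed.

(** The carried symbol [a] is again under the head in the unchanged state, so the machine for [- e]
    acts exactly on the states that were moved and swaps the cells back. *)
Lemma carryK q0 a e : cancel (carry q0 a e) (carry q0 a (- e)).
Proof.
apply: machine_cancel (carry_machine q0 a e) (carry_machine _ _ _) _ _ => z.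
  rewrite (Psi_carry q0 a e); case: ifPn => [/andP[qz az]|qaz]; last first.
    by rewrite Psi_carry (negbTE qaz).
  have az' : shift (- e) (swap_cell e z.1) 0 = a.
    rewrite shiftE sub0r opprK /swap_cell eqxx -(eqP az).
    by have [->|] := eqVneq e 0.
  by rewrite Psi_carry /= qz az' eqxx /= opprK swap_cellK -surjective_pairing.
rewrite (Psi_carry q0 a e) !movement_carry; case: ifPn => [/andP[qz az]|/negbTE->]; last first.
  by rewrite addr0.
rewrite /= qz shiftE sub0r opprK /swap_cell eqxx.
by have -> : (if e == 0 then e else 0) = 0 :> Zd d; [case: eqP | rewrite az addrN].
Qed.

Lemma RTM_carry q0 a e : RTM d n.+1 k (carry q0 a e).
Proof.
split; first exact: machine_is_TM (carry_machine _ _ _).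
exists (carry q0 a (- e)); split; first exact: machine_is_TM (carry_machine _ _ _).
  exact: carryK.
by rewrite -{2}[e]opprK; exact: carryK.
Qed.

End Examples.

(** * Tape-preserving machines *)


Section TapePreserving.
Variables d n k : nat.
Implicit Types (x y : config d n.+1) (u v : Zd d).
Variables (T : tapes d n.+1 k -> tapes d n.+1 k).

Lemma RFA_tape t : RFA d n.+1 k T -> (T t).1 = t.1.
Proof.
case=> _ [F [f [fp ->]]]; case: t => x h; rewrite /TM_of.
case: (find_head h) => [[v q]|//].
case: (fp [ffun u : F => x (v + val u)] q) => q' [e ->] /=.
apply/funext => t; case: insubP => [w _ wt|//].
by rewrite ffunE wt addrC subrK.
Qed.

Hypothesis hT : RFA d n.+1 k T.

(** The action of [T] on positions and states of the head over the fixed tape [x]. *)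
Let head_map x (vq : Zd d * 'I_k) : Zd d * 'I_k :=
  let z := (shift (- vq.1) x, vq.2) in (vq.1 + movement T z, (Psi T z).2).

Let TM_T : is_TM T. Proof. by case: hT => -[]. Qed.

Let head_mapE x vq :
  T (x, head_at vq.2 vq.1) = (x, head_at (head_map x vq).2 (head_map x vq).1).
Proof.
have := TM_at_origin (shift (- vq.1) x, vq.2) vq.1 TM_T.
have := RFA_tape (x, head_at vq.2 vq.1) hT.
by rewrite /at_origin /= shiftNK => Tx E; rewrite E /= in Tx *; rewrite Tx.
Qed.

Let head_map_inj x : injective (head_map x).
Proof.
move=> vq wr E; have := head_mapE x vq; rewrite E -head_mapE.
case: hT => -[_ [T' [_ TK _]]] _ /(can_inj TK)/pair_equal_spec[_ /head_at_inj[]].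
by case: vq wr {E} => [v q] [w r] /= -> ->.
Qed.

Let head_map_surj x wr : exists vq, wr = head_map x vq.
Proof.
case: hT => -[_ [T' [TM_T' TK T'K]]] _.
have := T'K (x, head_at wr.2 wr.1).
have := TM_at_origin (shift (- wr.1) x, wr.2) wr.1 TM_T'.
rewrite /at_origin /= shiftNK => ->; set y := shift _ _; set q := (Psi _ _).2.
set v := wr.1 + _ => E.
(* The inverse is only known to be a machine; the tape [y] it produces equals [x] because [T] sends
   it to [x] without changing it. *)
have yx : y = x by have := RFA_tape (y, head_at q v) hT; rewrite E.
exists (v, q); move: E; rewrite yx (head_mapE x (v, q)).
move=> /pair_equal_spec[_ /head_at_inj[? ?]].
exact: injective_projections.
Qed.

(* The head moves on the tapes [x] and [y] are two permutations of [Zd d * 'I_k]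
   which differ only on the finite set of heads seeing the origin, so both
   permutations map this set onto the same image. *)
Lemma RFA_sum_movement D st x y : machine D st T ->
  (forall u, u != 0 -> x u = y u) ->
  \sum_(u <- D) \sum_q movement T (shift u x, q) =
  \sum_(u <- D) \sum_q movement T (shift u y, q).
Proof.
move=> mT xy.
(* A head at [v] has the origin in its window exactly when [- v] lies in [D]. *)
pose A := [seq (- u, q) | u <- (D : seq (Zd d)), q <- enum 'I_k].
have out vq : vq \notin A -> head_map x vq = head_map y vq.
  move=> vqA.
  have ag : agree D (shift (- vq.1) x) (shift (- vq.1) y).
    apply/agreeP => u uD; rewrite !shiftE opprK; apply: xy.
    apply: contra vqA; rewrite addr_eq0 => /eqP uv.
    apply/allpairsP; exists (u, vq.2); rewrite /= mem_enum; split => //.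
    by rewrite uv opprK -surjective_pairing.
  rewrite /head_map (machine_movement mT) (machine_movement mT).
  rewrite (machine_Psi mT) (machine_Psi mT) /=.
  by have [-> -> _] := machine_local mT vq.2 ag.
have uA : uniq A.
  apply: allpairs_uniq; rewrite ?enum_uniq ?fset_uniq//.
  by move=> [u q] [v r] _ _ /= [/oppr_inj -> ->].
(* The image of [A] is the complement of the image of its complement, where the two permutations
   coincide. *)
have sub z z' vq : (forall a, a \notin A -> head_map z a = head_map z' a) ->
    vq \in map (head_map z) A -> vq \in map (head_map z') A.
  move=> zz' /mapP[a aA ->]; have [b zb] := head_map_surj z' (head_map z a).
  rewrite zb; apply: map_f; apply: contraT => bA.
  by move: zb; rewrite -zz'// => /head_map_inj ab; rewrite -ab aA in bA.
have perm : perm_eq (map (head_map x) A) (map (head_map y) A).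
  apply: uniq_perm; rewrite ?map_inj_uniq//; try exact: head_map_inj.
  by move=> vq; apply/idP/idP; apply: sub => // a /out.
(* The final positions sum to the initial ones plus the total displacement; the initial sum is
   independent of the tape. *)
have sumE z : \sum_(vq <- map (head_map z) A) vq.1 =
    \sum_(vq <- A) vq.1 + \sum_(u <- D) \sum_q movement T (shift u z, q).
  rewrite big_map big_split /=; congr (_ + _).
  rewrite big_allpairs_dep; apply: eq_bigr => u _; rewrite big_enum /=.
  by apply: eq_bigr => q _; rewrite opprK.
apply: (addrI (\sum_(vq <- A) vq.1)); rewrite -!sumE.
exact: perm_big.
Qed.

End TapePreserving.


(** Read a vector as the coefficients of a polynomial and evaluate at an integer [K]. This is
    additive, and injective on [D] once [K] avoids the roots of the finitely many nonzero
    differences. *)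
Lemma injective_functional d (D : {fset Zd d}) : exists2 phi : Zd d -> int,
  forall u v, phi (u - v) = phi u - phi v & {in D &, injective phi}.
Proof.
pose p (u v : Zd d) : {poly int} := if u == v then 1 else rVpoly (u - v).
pose P : {poly int} := \prod_(u <- D) \prod_(v <- D) p u v.
have P0 : P != 0.
  rewrite prodf_seq_neq0; apply/allP => u _; rewrite prodf_seq_neq0.
  apply/allP => v _; rewrite /= /p; case: ifPn => [_|uv]; first exact: oner_neq0.
  apply: contra uv => /eqP uv0; rewrite -subr_eq0; apply/eqP.
  by rewrite -[u - v]rVpolyK uv0 linear0.
have [K PK] : exists K : int, ~~ root P K.
  apply/not_existsP => allroot.
  (* These are [size P] distinct integers, more than the nonzero [P] has roots. *)
  pose s := [seq i%:Z | i <- iota 0 (size P)].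
  have : (size s < size P)%N.
    apply: max_poly_roots => //; first by apply/allP => K _; apply/negPn/negP/allroot.
    by rewrite map_inj_uniq ?iota_uniq// => i j [].
  by rewrite size_map size_iota ltnn.
exists (fun u => (rVpoly u).[K]) => [u v|u v uD vD E].
  by rewrite linearB hornerD hornerN.
apply/eqP; apply: contraNT PK => uv; rewrite /root /P horner_prod.
rewrite prodf_seq_eq0; apply/hasP; exists u => //=; rewrite horner_prod.
rewrite prodf_seq_eq0; apply/hasP; exists v => //=.
by rewrite /p (negbTE uv) linearB hornerD hornerN E subrr.
Qed.

(** A function on the integers that jumps only at points of [s] changes, across an interval
    containing them all, by the sum of its jumps. *)
Lemma telescope_uniq (V : zmodType) (s : seq int) (b : int -> V) :
  uniq s -> (forall c, c \notin s -> b c = b (c - 1)) ->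
  exists N : nat, (forall c, c \in s -> (`|c| <= N)%N) /\
    b N%:Z - b (- N%:Z - 1) = \sum_(c <- s) (b c - b (c - 1)).
Proof.
move=> us bs; pose N := (\max_(c <- s) `|c|)%N; exists N.
have sN c : c \in s -> (`|c| <= N)%N.
  by move=> cs; rewrite /N; exact: leq_bigmax_seq.
split => //.
(* Reindexes the interval from [- N - 1] to [N] by naturals, so that step [i] is the possible jump
   at [i - N]. *)
pose f (i : nat) := b (i%:Z - N%:Z - 1).
have -> : b N%:Z - b (- N%:Z - 1) = f (2 * N).+1 - f 0%N.
  by congr (b _ - b _); lia.
rewrite -telescope_sumr//.
transitivity (\sum_(0 <= i < (2 * N).+1) \sum_(c <- s | c == i%:Z - N%:Z) (b c - b (c - 1))).
  apply: eq_bigr => i _; rewrite /f.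
  have -> : i.+1%:Z - N%:Z - 1 = i%:Z - N%:Z by lia.
  have [cs|cs] := boolP (i%:Z - N%:Z \in s).
    by rewrite -big_filter filter_pred1_uniq// big_seq1.
  rewrite (bs _ cs) subrr big1_seq// => c /andP[/eqP-> cs'].
  by rewrite cs' in cs.
rewrite (exchange_big_dep xpredT)//=; apply: eq_big_seq => c cs.
have cN := sN _ cs.
rewrite (eq_bigl (fun i : nat => i == absz (c + N%:Z)%R)); last by move=> i; lia.
by rewrite big_nat1_eq ifT//; lia.
Qed.

(** * Average movement of tape-preserving machines *)


Section AverageRFA.
Variables (R : realType) (d n k : nat).
Local Notation state := (config d n.+1 * 'I_k.+1)%type.
Local Notation expect := (@expect R d n k).
Implicit Types (x w : config d n.+1) (D : {fset Zd d}) (g : state -> R).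

Lemma expect_cst (a : R) : expect (fun=> a) = a.
Proof.
have [_ ->] := @expect_local R d n k fset0 (fun=> a) (fun _ _ _ _ => erefl).
rewrite big_const iter_addr_0 card_prod card_ffun card_ord -cardfE cardfs0 expn0 mul1n.
by rewrite expr0 invr1 mul1r card_ord -[a *+ _]mulr_natr mulfK// pnatr_eq0.
Qed.

(** Shifting the tape by [u] is [Psi] of the machine that always walks by [- u]. *)
Lemma expect_shift D g u : local_on D g ->
  expect (fun z => g (shift u z.1, z.2)) = expect g.
Proof.
move=> gD; have [_ <-] := expect_Psi (RTM_walk n (fun _ : 'I_k.+1 => - u)) gD.
by congr expect; apply/funext => z /=; rewrite Psi_walk opprK.
Qed.

Lemma expect_marginal D g : local_on D g ->
  expect (fun z => \sum_q g (z.1, q)) = k.+1%:R * expect g.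
Proof.
move=> gD; have [_ ->] := expect_local gD.
have hD : local_on D (fun z : state => \sum_q g (z.1, q)).
  by move=> x y q xy /=; apply: eq_bigr => r _; exact: gD.
have [_ ->] := expect_local hD; rewrite mulrA; congr (_ * _).
rewrite -(pair_bigA _ (fun (p : {ffun D -> 'I_n.+1}) q => \sum_r g (extend p, r))) /=.
rewrite -(pair_bigA _ (fun (p : {ffun D -> 'I_n.+1}) q => g (extend p, q))) /=.
rewrite mulr_sumr; apply: eq_bigr => p _.
by rewrite sumr_const card_ord mulr_natl.
Qed.

Definition coord_movement (T : tapes d n.+1 k.+1 -> tapes d n.+1 k.+1) (i : 'I_d)
  (z : state) : R := (movement T z 0 i)%:~R.

Lemma local_movement D st T i : machine D st T -> local_on D (coord_movement T i).
Proof.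
move=> mT x y q xy; rewrite /coord_movement !(machine_movement mT).
by have [_ -> _] := machine_local mT q xy.
Qed.

Variables (T : tapes d n.+1 k.+1 -> tapes d n.+1 k.+1) (hT : RFA d n.+1 k.+1 T).
Variable i : 'I_d.

Let M x : R := \sum_q coord_movement T i (x, q).

(** Interpolates, as [c] grows, between the zero tape and [x] on any finite window. *)
Let mask (phi : Zd d -> int) (c : int) x : config d n.+1 :=
  fun t => if phi t <= c then x t else ord0.

(* Compare the tapes [Y] and [Y'] where [Y] is [w] masked to [phi <= 0] and [Y']
   is [Y] with the origin erased: seen from a cell [u] of the window, they look
   like [shift u w] masked to [phi <= phi u] and to [phi < phi u]. *)
Let sum_mask D st (phi : Zd d -> int) w : machine D st T ->
  (forall u v, phi (u - v) = phi u - phi v) -> {in D &, injective phi} ->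
  \sum_(u : D) M (mask phi (phi (val u)) (shift (val u) w)) =
  \sum_(u : D) M (mask phi (phi (val u) - 1) (shift (val u) w)).
Proof.
move=> mT phiB phiI.
pose Y : config d n.+1 := mask phi 0 w.
pose Y' : config d n.+1 := fun t => if t == 0 then ord0 else Y t.
have MY y : ((\sum_(u <- D) \sum_q movement T (shift u y, q)) 0 i)%:~R =
    \sum_(u : D) M (shift (val u) y).
  transitivity (\sum_(u <- D) M (shift u y)); last by rewrite big_seq_fsetE.
  rewrite summxE rmorph_sum /=; apply: eq_bigr => u _.
  by rewrite summxE rmorph_sum.
transitivity (\sum_(u : D) M (shift (val u) Y)).
  apply: eq_bigr => u _; congr M; apply/funext => t.
  by rewrite /Y /mask !shiftE phiB subr_le0.
rewrite -MY (@RFA_sum_movement _ _ _ _ hT D st Y Y')//; last first.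
  by move=> u /negbTE u0; rewrite /Y' u0.
rewrite MY; apply: eq_bigr => u _; apply: eq_bigr => q _.
apply: (local_movement i mT); apply/agreeP => t tD.
(* By injectivity of [phi] on [D], the cell [u] is the only one of the window at level [phi u], so
   erasing it lowers the threshold by one. *)
rewrite /Y' shiftE subr_eq0 /Y /mask phiB subr_le0 -ltzD1 subrK lt_neqAle.
case: eqVneq => [->|tu]; first by rewrite eqxx.
by case: eqP => [/(phiI _ _ tD (valP u)) /eqP|_]; [rewrite (negbTE tu) | rewrite shiftE].
Qed.

(** The mean [b c] over masked tapes jumps only at values of [phi] on [D]. By [sum_mask] and shift
    invariance these jumps add up to zero, so random tapes and the zero tape give the same mean. *)
Lemma expect_RFA_movement : exists m : int,
  expect (coord_movement T i) = m%:~R / k.+1%:R.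
Proof.
have [D [st mT]] : exists D st, machine D st T.
  by apply: is_TM_machine; case: hT => -[].
have [phi phiB phiI] := injective_functional D.
have ML x y : agree D x y -> M x = M y.
  by move=> xy; apply: eq_bigr => q _; exact: (local_movement i mT).
have mL c : local_on D (fun z : state => M (mask phi c z.1)).
  move=> x y q /agreeP xy; apply: ML; apply/agreeP => u uD /=.
  by rewrite /mask; case: ifP => // _; exact: xy.
pose b c := expect (fun z => M (mask phi c z.1)).
have b_shift c u : expect (fun z => M (mask phi c (shift u z.1))) = b c.
  exact: (expect_shift u (mL c)).
(* Each term is rewritten with the tape shifted by its own [u], which preserves the mean and gives
   the sums that [sum_mask] compares pointwise. *)
have b_sum (f : Zd d -> int) : \sum_(u <- D) b (f u) =
    expect (fun z => \sum_(u : D) M (mask phi (f (val u)) (shift (val u) z.1))).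
  rewrite big_seq_fsetE /=.
  have h (u : D) : has_expect (fun z : state => M (mask phi (f (val u)) (shift (val u) z.1))).
    have [] := expect_Psi (RTM_walk n (fun _ : 'I_k.+1 => - val u)) (mL (f (val u))).
    by rewrite (_ : _ \o _ = fun z => M (mask phi (f (val u)) (shift (val u) z.1)))//;
       apply/funext => z /=; rewrite Psi_walk opprK.
  have [_] := expect_sum (fun=> 1) h.
  under [X in expect X = _]eq_fun do under eq_bigr do rewrite mul1r.
  by move=> ->; apply: eq_bigr => u _; rewrite mul1r b_shift.
have uphi : uniq (map phi D) by rewrite map_inj_in_uniq ?fset_uniq.
have b_const c : c \notin map phi D -> b c = b (c - 1).
  move=> cD; congr expect; apply/funext => z; apply: ML; apply/agreeP => u uD.
  have uc : phi u != c by apply: contra cD => /eqP <-; exact: map_f.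
  by rewrite /mask (_ : (phi u <= c) = (phi u <= c - 1))//; lia.
have [N [DN]] := telescope_uniq uphi b_const.
rewrite big_map sumrB (b_sum phi) (b_sum (fun u => phi u - 1)).
rewrite [X in _ = X - _](_ : _ = expect (fun z =>
    \sum_(u : D) M (mask phi (phi (val u) - 1) (shift (val u) z.1)))); last first.
  by congr expect; apply/funext => z; exact: (sum_mask _ mT).
rewrite subrr => /subr0_eq bN.
have phiN u : u \in D -> - N%:Z <= phi u <= N%:Z.
  by move=> uD; have := DN _ (map_f phi uD); lia.
(* On the window, threshold [N] masks nothing and threshold [- N - 1] masks everything. *)
have EM : expect (fun z => M z.1) = M (fun=> ord0).
  transitivity (b N%:Z).
    congr expect; apply/funext => z; apply: ML; apply/agreeP => u /phiN /andP[_ uN].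
    by rewrite /mask uN.
  rewrite bN -[RHS]expect_cst; congr expect; apply/funext => z; apply: ML.
  apply/agreeP => u /phiN uN; rewrite /mask ifF//; lia.
exists (\sum_q movement T (fun=> ord0, q) 0 i).
rewrite rmorph_sum /= -[X in X / _]/(M (fun=> ord0)) -EM.
by rewrite (expect_marginal (local_movement i mT)) mulrC mulKf// pnatr_eq0.
Qed.

End AverageRFA.

(** * The homomorphism alpha *)


Section Alpha.
Variables (R : realType) (d n k : nat).
Local Notation alpha := (alpha R d.+1 n.+1 k).
Local Notation expect := (@expect R d.+1 n.+1 k).
Local Notation RTM := (RTM d.+1 n.+2 k.+1).
Local Notation RFA := (RFA d.+1 n.+2 k.+1).
Local Notation LP := (LP d.+1 n.+2 k.+1).
Local Notation EL := (EL d.+1 n.+2 k.+1).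
Local Notation lattice := (fraction_lattice R d.+1 k.+1).
Implicit Types T : tapes d.+1 n.+2 k.+1 -> tapes d.+1 n.+2 k.+1.

Lemma alphaE T i : is_TM T -> alpha T 0 i = - expect (coord_movement R T i).
Proof.
move=> hT; have [D [st mT]] := is_TM_machine hT.
have hE := has_expect_local (local_movement R i mT).
rewrite mxE shift_indicator_TM// -mulN1r -expectZ//.
by apply: eq_Rintegral => z _; rewrite mxE mulN1r -rmorphN.
Qed.

(** The cocycle identity gives the movement of [T'] plus that of [T] after [Psi T'], and the latter
    has the same mean as that of [T]. *)
Lemma alpha_comp T T' : RTM T -> RTM T' -> alpha (T \o T') = alpha T + alpha T'.
Proof.
move=> rT rT'; have [hT hT'] : is_TM T /\ is_TM T' by case: rT; case: rT'.
have hTT' := TM_comp hT hT'.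
apply/matrixP => z i; rewrite ord1 [RHS]mxE !alphaE// -opprD; congr (- _).
have [D [st mT]] := is_TM_machine hT; have [D' [st' mT']] := is_TM_machine hT'.
have hE' := has_expect_local (local_movement R i mT').
have [hE <-] := expect_Psi rT' (local_movement R i mT).
rewrite addrC -expectD//; congr expect; apply/funext => y.
rewrite /coord_movement /=; have [_ ->] := Psi_movement_comp y hT hT' hTT'.
by rewrite mxE rmorphD.
Qed.

Lemma alpha_id : alpha id = 0.
Proof.
have [_ rid _ _] := RTM_subgroup d.+1 n.+1 k.+1.
have idE : alpha id = alpha id + alpha id := alpha_comp rid rid.
by apply: (addrI (alpha id)); rewrite addr0 -idE.
Qed.

Lemma alpha_inv T T' : RTM T -> cancel T T' -> cancel T' T -> alpha T' = - alpha T.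
Proof.
move=> rT TK T'K; have [_ _ _ /(_ T T' rT TK T'K) rT'] := RTM_subgroup d.+1 n.+1 k.+1.
apply/eqP; rewrite -addr_eq0 addrC -alpha_comp//.
rewrite (_ : T \o T' = id); last exact/funext.
by rewrite alpha_id.
Qed.

Lemma lattice0 : lattice 0.
Proof. by move=> i; exists 0; rewrite mxE mul0r. Qed.

Lemma latticeD u v : lattice u -> lattice v -> lattice (u + v).
Proof.
move=> hu hv i; have [a ua] := hu i; have [b vb] := hv i.
by exists (a + b); rewrite mxE ua vb rmorphD mulrDl.
Qed.

Lemma latticeN u : lattice u -> lattice (- u).
Proof.
by move=> hu i; have [a ua] := hu i; exists (- a); rewrite mxE ua rmorphN mulNr.
Qed.

Lemma alpha_RFA T : RFA T -> lattice (alpha T).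
Proof.
move=> hT i; have [m Em] := expect_RFA_movement R hT i.
exists (- m); rewrite alphaE; last by case: hT => -[].
by rewrite Em rmorphN mulNr.
Qed.

Lemma alpha_LP T : LP T -> alpha T = 0.
Proof.
move=> [[hT _] [F [F' [f [f0 TE]]]]]; apply/matrixP => z i; rewrite ord1 alphaE// mxE.
rewrite (_ : coord_movement R T i = fun=> 0) ?expect_cst ?oppr0//.
apply/funext => y; rewrite /coord_movement /movement /at_origin TE /= find_head_at.
have := f0 [ffun u : F => shift 0 y.1 (0 + val u)] y.2.
by case: (f _) => -[p q] e /= ->; rewrite find_head_at addr0 mxE.
Qed.

(** Machines with [alpha] in the lattice form a subgroup of [RTM], which contains both families of
    generators. *)
Lemma alpha_EL T : EL T -> lattice (alpha T).
Proof.
have [_ rid rcomp rinv] := RTM_subgroup d.+1 n.+1 k.+1.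
pose H := [set T | RTM T /\ lattice (alpha T)].
suff /(_ T) h : EL `<=` H by move=> /h[].
apply: smallest_sub.
  split.
  - by move=> ? [].
  - split => //.
    by rewrite alpha_id; exact: lattice0.
  - move=> g h [rg lg] [rh lh]; split; first exact: rcomp.
    by rewrite alpha_comp//; exact: latticeD.
  - move=> g h [rg lg] gK hK; split; first exact: rinv gK hK.
    by rewrite (alpha_inv rg gK hK); exact: latticeN.
move=> g [rg|lg]; split; [by case: rg| exact: alpha_RFA | by case: lg |].
by rewrite alpha_LP//; exact: lattice0.
Qed.

Lemma alpha_RFA_onto v : lattice v -> exists2 T, RFA T & alpha T = v.
Proof.
move=> hv; pose m i := sval (cid (hv i)).
(* The sign offsets that of [alpha]; moving in one state out of [k.+1] supplies the denominator. *)
pose e : Zd d.+1 := \row_i - m i.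
pose mv (q : 'I_k.+1) : Zd d.+1 := if q == ord0 then e else 0.
pose T : tapes d.+1 n.+2 k.+1 -> tapes d.+1 n.+2 k.+1 := walk mv.
exists T; first exact: RFA_walk.
have hT : is_TM T by case: (RTM_walk n.+1 mv).
apply/matrixP => z i; rewrite ord1 alphaE// (svalP (cid (hv i))) -/(m i).
rewrite (_ : coord_movement R _ i = fun z => (- m i)%:~R * cyl R fset0 (fun=> ord0) ord0 z).
  rewrite expectZ; last exact: has_expect_cyl.
  by rewrite expect_cyl cardfs0 expr0 invr1 mul1r rmorphN mulNr opprK.
apply/funext => -[x q]; rewrite /coord_movement movement_walk /mv /cyl /=.
have -> : agree fset0 x (fun=> ord0) by apply/agreeP => u; rewrite inE.
by case: eqP => _ /=; rewrite mxE ?mulr1 ?mulr0.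
Qed.

(** Carrying one symbol in one state has movement of mean [1 / (n.+2 * k.+1)] in each coordinate,
    outside the lattice since [n.+2] exceeds 1. *)
Lemma carry_not_EL : exists2 T, RTM T & ~ EL T.
Proof.
pose e : Zd d.+1 := const_mx 1; pose T := carry (ord0 : 'I_k.+1) (ord_max : 'I_n.+2) e.
have rT : RTM T by exact: RTM_carry.
exists T => // /alpha_EL /(_ ord0)[m].
rewrite alphaE; last by case: rT.
rewrite (_ : coord_movement R _ _ = cyl R [fset 0]%fset (fun=> ord_max) ord0).
  rewrite expect_cyl cardfs1 expr1 -mulNr => /(mulIf (invr_neq0 _)).
  rewrite pnatr_eq0 => /(_ isT) /(congr1 ( *%R n.+2%:R)).
  (* What remains is [n.+2 * m = -1] over the integers, impossible by absolute values. *)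
  rewrite mulrN mulfV ?pnatr_eq0// => /eqP; rewrite -[n.+2%:R]/(n.+2%:Z%:~R) -intrM.
  rewrite -(rmorphN1 intr) eqr_int => /eqP /(congr1 absz).
  by rewrite abszM => /esym/eqP; rewrite muln_eq1.
apply/funext => -[x q]; rewrite /coord_movement movement_carry /cyl /= andbC.
have -> : agree [fset 0]%fset x (fun=> ord_max) = (x 0 == ord_max).
  by apply/agreeP/eqP => [->//|x0 u]; rewrite ?inE// => /eqP->.
by case: ifP; rewrite mxE.
Qed.

End Alpha.

(** The successors encode dimension and number of states at least 1 and alphabet size at least 2. *)
Theorem proposition8 (R : realType) (d n k : nat) :
  [/\ alpha R d.+1 n.+1 k @` RFA d.+1 n.+2 k.+1
         = fraction_lattice R d.+1 k.+1,
      alpha R d.+1 n.+1 k @` EL d.+1 n.+2 k.+1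
         = fraction_lattice R d.+1 k.+1
    & EL d.+1 n.+2 k.+1 `<` RTM d.+1 n.+2 k.+1].
Proof.
have RFA_EL : RFA d.+1 n.+2 k.+1 `<=` EL d.+1 n.+2 k.+1.
  by move=> T hT; apply: sub_gen_smallest; left.
split.
- apply/seteqP; split => [_ [T hT <-]|v /(alpha_RFA_onto n)[T hT <-]].
    exact: alpha_RFA.
  by exists T.
- apply/seteqP; split => [_ [T hT <-]|v /(alpha_RFA_onto n)[T hT <-]].
    exact: alpha_EL.
  by exists T => //; exact: RFA_EL.
- rewrite properEneq; split; last exact: EL_sub_RTM.
  have [T rT nT] := carry_not_EL R d n k.
  by apply/eqP => E; rewrite E in nT.
Qed.
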